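(* Let $\mathcal C$ be a small category satisfying the nine axioms (A1)–(A9). Let $e:A\to D$ be an epimorphism and $m:D\to B$ a strong monomorphism. If $D\neq1$, then the terminal object $(C,c,u)$ of $\mathcal F(e,m)$ (which exists) is a final pullback complement of $(e,m)$. Consequently, for every nonconstant morphism of $\mathcal C$, its factorization as an epimorphism followed by a strong monomorphism has a final pullback complement.
   Context: AXIOMS. Let $\mathcal C$ be a small category. A monomorphism $m:A\to B$ is strong if for every epimorphism $e:P\to Q$ and all $a:P\to A$, $b:Q\to B$ with $ma=be$ there is $\ell:Q\to A$ with $\ell e=a$ and $m\ell=b$. The nine axioms are: (A1) There is a terminal object $1$ (fixed); $q_X:X\to 1$ is the unique morphism, and a point of $Y$ is a morphism $1\to Y$. (A2) Every morphism factors as $me$ with $e$ an epimorphism and $m$ a strong monomorphism. (A3) For every epimorphism $d:X\to Y$ and strong monomorphism $v:B\to Y$ the pullback of $d$ and $v$ exists and its projection to $B$ is an epimorphism. (A4) For every strong monomorphism $u:A\to X$ and epimorphism $a:A\to B$ there is a pushout square $cu=va$ ($c:X\to Y$, $v:B\to Y$) with $v$ a strong monomorphism, and this square is also a pullback. (A5) The class of epimorphisms whose pullbacks along all but at most one point of their codomain are isomorphisms is stable under pushout along strong monomorphisms. (A6) For every object $A$ and point $j:1\to B$ the category $\mathcal F(A,j)$ has a terminal object. Its objects are triples $(C,d,u)$ with $u:A\to C$ a strong monomorphism and $d:C\to B$ an epimorphism such that the square $du=jq_A$ is a pullback; its morphisms $(C',d',u')\to(C,d,u)$ are morphisms $h:C'\to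 C$ with $hu'=u$ and $dh=d'$. (A7) For every object $X$ there are finitely many strong monomorphisms with codomain $X$ and finitely many epimorphisms with domain $X$ (counted as individual arrows, with all possible other endpoints). (A8) For every commutative square of strong monomorphisms $ca=db$ ($a:W\to X$, $b:W\to Y$, $c:X\to Z$, $d:Y\to Z$) there is $h:X\to Y$ with $ha=b$, $dh=c$, or there is $k:Y\to X$ with $kb=a$, $ck=d$. (A9) If the pullback of an epimorphism $d:X\to Y$ along every point of $Y$ is an isomorphism, then $d$ is an identity. Here ''the pullback of $d$ along a point $j:1\to Y$'' is the projection $X\times_Y1\to1$. Under the axioms, the factorization in (A2) is unique. DEFINITIONS. A morphism $f:X\to Y$ is constant if $f=jq_X$ for some point $j:1\to Y$. For an epimorphism $e:A\to D$ and a strong monomorphism $m:D\to B$, the objects of $\mathcal F(e,m)$ are triples $(C,c,u)$ with $u:A\to C$ a morphism and $c:C\to B$ an epimorphism such that the square $cu=me$ is a pullback; a morphism $(C',c',u')\to(C,c,u)$ is $h:C'\to C$ with $hu'=u$ and $ch=c'$. A pullback square $cu=me$ (with $u:A\to C$, $c:C\to B$) is a final pullback complement of the composable pair $(e,m)$ if for every pullback square $c'u'=me'$ (with $u':A'\to C'$, $c':C'\to B$, $e':A'\to D$ arbitrary morphisms) and every $f:A'\to A$ with $ef=e'$ there is a unique $h:C'\to C$ with $ch=c'$ and $hu'=uf$. *)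

(* Defs.v *)
From Stdlib Require Import Ensembles Finite_sets.

Set Implicit Arguments.
Unset Strict Implicit.
Unset Printing Implicit Defensive.

Declare Scope cat_scope.
Delimit Scope cat_scope with cat.
Local Open Scope cat_scope.

Record category := Category {
  Obj :> Type;
  Hom : Obj -> Obj -> Type;
  idm : forall X, Hom X X;
  comp : forall X Y Z, Hom Y Z -> Hom X Y -> Hom X Z;
  compA : forall W X Y Z (h : Hom Y Z) (g : Hom X Y) (f : Hom W X),
    comp h (comp g f) = comp (comp h g) f;
  comp1m : forall X Y (f : Hom X Y), comp (idm Y) f = f;
  compm1 : forall X Y (f : Hom X Y), comp f (idm X) = f
}.

Arguments idm {c} X.
Notation "X ~> Y" := (Hom X Y) (at level 99, right associativity) : cat_scope.
Notation "g ∘ f" := (comp g f) (at level 40, left associativity) : cat_scope.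

Definition epi (C : category) (X Y : C) (e : X ~> Y) : Prop :=
  forall (Z : C) (g h : Y ~> Z), g ∘ e = h ∘ e -> g = h.

Definition mono (C : category) (X Y : C) (m : X ~> Y) : Prop :=
  forall (W : C) (g h : W ~> X), m ∘ g = m ∘ h -> g = h.

Definition iso (C : category) (X Y : C) (f : X ~> Y) : Prop :=
  exists g : Y ~> X, g ∘ f = idm X /\ f ∘ g = idm Y.

(* Being an identity includes the equality of the two endpoints. *)
Inductive is_identity (C : category) : forall X Y : C, (X ~> Y) -> Prop :=
| is_identity_idm (X : C) : is_identity (idm X).

Definition strong_mono (C : category) (A B : C) (m : A ~> B) : Prop :=
  mono m /\
  forall (P Q : C) (e : P ~> Q) (a : P ~> A) (b : Q ~> B),
    epi e -> m ∘ a = b ∘ e -> exists l : Q ~> A, l ∘ e = a /\ m ∘ l = b.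

(* [is_pullback f g p q]: the commutative square f p = g q exhibits (p, q) as
   the pullback of the cospan (f, g). *)
Definition is_pullback (C : category) (X Y Z P : C)
    (f : X ~> Z) (g : Y ~> Z) (p : P ~> X) (q : P ~> Y) : Prop :=
  f ∘ p = g ∘ q /\
  forall (W : C) (a : W ~> X) (b : W ~> Y), f ∘ a = g ∘ b ->
    exists! h : W ~> P, p ∘ h = a /\ q ∘ h = b.

(* [is_pushout f g p q]: the commutative square p f = q g exhibits (p, q) as
   the pushout of the span (f, g). *)
Definition is_pushout (C : category) (X Y Z P : C)
    (f : Z ~> X) (g : Z ~> Y) (p : X ~> P) (q : Y ~> P) : Prop :=
  p ∘ f = q ∘ g /\
  forall (W : C) (a : X ~> W) (b : Y ~> W), a ∘ f = b ∘ g ->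
    exists! h : P ~> W, h ∘ p = a /\ h ∘ q = b.

Record terminal_object (C : category) := TerminalObject {
  one :> Obj C;
  to_one : forall X : C, X ~> one;
  to_one_unique : forall (X : C) (f : X ~> one), f = to_one X
}.

Definition constant (C : category) (T : terminal_object C) (X Y : C)
    (f : X ~> Y) : Prop :=
  exists j : one T ~> Y, f = j ∘ to_one T X.

(* The pullback of d along the point j (its projection to the terminal object)
   exists and is an isomorphism; by uniqueness of pullbacks up to isomorphism
   the choice of the pullback is irrelevant. *)
Definition iso_over_point (C : category) (T : terminal_object C) (X Y : C)
    (d : X ~> Y) (j : one T ~> Y) : Prop :=
  exists (P : C) (p : P ~> X) (q : P ~> one T), is_pullback d j p q /\ iso q.

Definition iso_off_one_point (C : category) (T : terminal_object C) (X Y : C)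
    (d : X ~> Y) : Prop :=
  epi d /\
  forall j j' : one T ~> Y,
    ~ iso_over_point d j -> ~ iso_over_point d j' -> j = j'.

Definition F_point_obj (C : category) (T : terminal_object C) (A B : C)
    (j : one T ~> B) (X : C) (d : X ~> B) (u : A ~> X) : Prop :=
  strong_mono u /\ epi d /\ is_pullback d j u (to_one T A).

Definition F_point_terminal (C : category) (T : terminal_object C) (A B : C)
    (j : one T ~> B) (X : C) (d : X ~> B) (u : A ~> X) : Prop :=
  F_point_obj j d u /\
  forall (X' : C) (d' : X' ~> B) (u' : A ~> X'), F_point_obj j d' u' ->
    exists! h : X' ~> X, h ∘ u' = u /\ d ∘ h = d'.

Definition F_obj (C : category) (A D B : C) (e : A ~> D) (m : D ~> B)
    (X : C) (c : X ~> B) (u : A ~> X) : Prop :=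
  epi c /\ is_pullback c m u e.

Definition F_terminal (C : category) (A D B : C) (e : A ~> D) (m : D ~> B)
    (X : C) (c : X ~> B) (u : A ~> X) : Prop :=
  F_obj e m c u /\
  forall (X' : C) (c' : X' ~> B) (u' : A ~> X'), F_obj e m c' u' ->
    exists! h : X' ~> X, h ∘ u' = u /\ c ∘ h = c'.

Definition final_pullback_complement (C : category) (A D B : C)
    (e : A ~> D) (m : D ~> B) (X : C) (c : X ~> B) (u : A ~> X) : Prop :=
  is_pullback c m u e /\
  forall (X' A' : C) (c' : X' ~> B) (u' : A' ~> X') (e' : A' ~> D),
    is_pullback c' m u' e' ->
    forall f : A' ~> A, e ∘ f = e' ->
      exists! h : X' ~> X, c ∘ h = c' /\ h ∘ u' = u ∘ f.

(* The terminal object is the parameter T. The finiteness axioms count arrows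
   together with their varying endpoint, hence the sigma types. *)
Record nine_axioms (C : category) (T : terminal_object C) : Prop := NineAxioms {
  epi_strong_mono_factorization :
    forall (X Y : C) (f : X ~> Y),
      exists (D : C) (e : X ~> D) (m : D ~> Y),
        epi e /\ strong_mono m /\ f = m ∘ e;

  epi_pullback_strong_mono :
    forall (X Y B : C) (d : X ~> Y) (v : B ~> Y), epi d -> strong_mono v ->
      exists (P : C) (p : P ~> X) (q : P ~> B), is_pullback d v p q /\ epi q;

  strong_mono_pushout_epi :
    forall (A X B : C) (u : A ~> X) (a : A ~> B), strong_mono u -> epi a ->
      exists (Y : C) (c : X ~> Y) (v : B ~> Y),
        is_pushout u a c v /\ strong_mono v /\ is_pullback c v u a;

  iso_off_one_point_pushout :
    forall (A X B Y : C) (u : A ~> X) (a : A ~> B) (c : X ~> Y) (v : B ~> Y),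
      strong_mono u -> iso_off_one_point T a -> is_pushout u a c v ->
      iso_off_one_point T c;

  F_point_has_terminal :
    forall (A B : C) (j : one T ~> B),
      exists (X : C) (d : X ~> B) (u : A ~> X), F_point_terminal j d u;

  finite_strong_monos :
    forall X : C,
      Finite {A : C & A ~> X} (fun f => strong_mono (projT2 f));

  finite_epis :
    forall X : C,
      Finite {Y : C & X ~> Y} (fun f => epi (projT2 f));

  strong_mono_square_comparable :
    forall (W X Y Z : C) (a : W ~> X) (b : W ~> Y) (c : X ~> Z) (d : Y ~> Z),
      strong_mono a -> strong_mono b -> strong_mono c -> strong_mono d ->
      c ∘ a = d ∘ b ->
      (exists h : X ~> Y, h ∘ a = b /\ d ∘ h = c) \/
      (exists k : Y ~> X, k ∘ b = a /\ c ∘ k = d);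

  iso_over_all_points_identity :
    forall (X Y : C) (d : X ~> Y), epi d ->
      (forall j : one T ~> Y, iso_over_point d j) -> is_identity d
}.

(* Main.v *)
(* If [D <> 1] and [e : A ~> D] is an epimorphism, a strong subobject of [A]
   mapping onto [D] is all of [A]: by (A8) it contains every fibre of [e].
   Hence an object of [F(A, j)] over a base other than [1] is terminal as soon
   as its fibres off [j] are trivial, and such objects are stable under pulling
   the base back along strong monomorphisms.  Using (A4) and (A5), this yields a
   final pullback complement when [e] has only one nontrivial fibre.  In
   general [e] is a composite of such collapses, by induction on the number of
   epimorphisms out of [A] (A7), ending with (A9); final pullback complements
   compose. *)

From Stdlib Require Import ssreflect Classical FinFun Ensembles Finite_sets List.
Require Import Defs.

Local Open Scope cat_scope.

Lemma postcomp_eq {C : category} {X Y Z : C} {g : Y ~> Z} {f : X ~> Y} {k : X ~> Z} :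
  g ∘ f = k -> forall W (h : Z ~> W), h ∘ g ∘ f = h ∘ k.
Proof. by move=> <- W h; rewrite compA. Qed.

(* Rewrites with [H : g ∘ f = k] inside a left-associated composite. *)
Ltac crw H :=
  rewrite ?compA; first [rewrite (postcomp_eq H) | rewrite H]; rewrite ?compA.

(** * Epimorphisms, strong monomorphisms and pullbacks in an arbitrary category *)

Section Arrows.
Context {C : category}.
Implicit Types X Y Z W : C.

Lemma epi_comp {X Y Z} {g : Y ~> Z} {f : X ~> Y} : epi g -> epi f -> epi (g ∘ f).
Proof. by move=> hg hf W a b E; apply: hg; apply: hf; rewrite -!compA. Qed.

Lemma epi_cancel {X Y Z} {g : Y ~> Z} {f : X ~> Y} : epi (g ∘ f) -> epi g.
Proof. by move=> h W a b E; apply: h; rewrite !compA E. Qed.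

Lemma iso_idm X : iso (idm X).
Proof. by exists (idm X); rewrite comp1m. Qed.

Lemma iso_comp {X Y Z} {g : Y ~> Z} {f : X ~> Y} : iso g -> iso f -> iso (g ∘ f).
Proof.
move=> [g' [Eg1 Eg2]] [f' [Ef1 Ef2]]; exists (f' ∘ g'); split.
  by crw Eg1; rewrite compm1.
by crw Ef2; rewrite compm1.
Qed.

Lemma iso_epi {X Y} {f : X ~> Y} : iso f -> epi f.
Proof.
move=> [f' [_ E]] W a b /(f_equal (fun t => t ∘ f')).
by rewrite -!compA E !compm1.
Qed.

Lemma split_mono_strong {X Y} {f : X ~> Y} {r : Y ~> X} :
  r ∘ f = idm X -> strong_mono f.
Proof.
move=> E; split=> [W a b H|P Q e a b he H].
  by rewrite -(comp1m a) -(comp1m b) -E -!compA H.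
have Ea : r ∘ b ∘ e = a by rewrite -compA -H compA E comp1m.
by exists (r ∘ b); split=> //; apply: he; rewrite -compA Ea.
Qed.

Lemma iso_strong_mono {X Y} {f : X ~> Y} : iso f -> strong_mono f.
Proof. by move=> [g [E _]]; apply: split_mono_strong E. Qed.

Lemma epi_section_iso {X Y} {f : X ~> Y} {r : Y ~> X} :
  r ∘ f = idm X -> epi f -> iso f.
Proof.
move=> E hf; exists r; split=> //; apply: hf.
by rewrite -compA E compm1 comp1m.
Qed.

Lemma strong_mono_comp {X Y Z} {g : Y ~> Z} {f : X ~> Y} :
  strong_mono g -> strong_mono f -> strong_mono (g ∘ f).
Proof.
move=> [mg sg] [mf sf]; split=> [W a b H|P Q e a b he H].
  by apply: mf; apply: mg; rewrite !compA.
have [l [El1 El2]] : exists l : Q ~> Y, l ∘ e = f ∘ a /\ g ∘ l = b.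
  by apply: sg => //; rewrite compA.
have [l' [E1 E2]] := sf _ _ e a l he (eq_sym El1).
by exists l'; rewrite -compA E2.
Qed.

Lemma strong_mono_cancel {X Y Z} {g : Y ~> Z} {f : X ~> Y} :
  strong_mono (g ∘ f) -> strong_mono f.
Proof.
move=> [m s]; split=> [W a b H|P Q e a b he H].
  by apply: m; rewrite -!compA H.
have [l [E1 E2]] : exists l : Q ~> X, l ∘ e = a /\ g ∘ f ∘ l = g ∘ b.
  by apply: s => //; rewrite -!compA H.
by exists l; split=> //; apply: he; rewrite -compA E1.
Qed.

Lemma epi_strong_mono_iso {X Y} {f : X ~> Y} : epi f -> strong_mono f -> iso f.
Proof.
move=> hf [_ /(_ _ _ f (idm X) (idm Y) hf)].
by rewrite compm1 comp1m => /(_ eq_refl) [l [E1 E2]]; exists l.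
Qed.

Lemma is_identity_iso {X Y} {f : X ~> Y} : is_identity f -> iso f.
Proof. by case=> Z; apply: iso_idm. Qed.

Lemma is_identity_eq {X Y} {f : X ~> Y} : is_identity f -> X = Y.
Proof. by case. Qed.

(** With [v] monic the second projection of a lift comes for free, and with [u] monic so does
    uniqueness. *)
Lemma pullback_mono_intro {X Y B P} {d : X ~> Y} {v : B ~> Y} {u : P ~> X} {e : P ~> B} :
  mono v -> mono u -> d ∘ u = v ∘ e ->
  (forall W (a : W ~> X) (b : W ~> B), d ∘ a = v ∘ b -> exists h : W ~> P, u ∘ h = a) ->
  is_pullback d v u e.
Proof.
move=> mv mu E H; split=> // W a b Eab; have [h Eh] := H _ _ _ Eab.
exists h; split; last by move=> h' [E' _]; apply: mu; rewrite Eh.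
by split=> //; apply: mv; rewrite compA -E -compA Eh.
Qed.

Lemma pullback_lift {X Y B P} {d : X ~> Y} {v : B ~> Y} {u : P ~> X} {e : P ~> B} :
  is_pullback d v u e ->
  forall W (a : W ~> X) (b : W ~> B), d ∘ a = v ∘ b ->
  exists h : W ~> P, u ∘ h = a /\ e ∘ h = b.
Proof. by move=> [_ H] W a b /H [h [E _]]; exists h. Qed.

Lemma pullback_strong_mono {X Y B P} {d : X ~> Y} {v : B ~> Y} {u : P ~> X} {e : P ~> B} :
  is_pullback d v u e -> strong_mono v -> strong_mono u.
Proof.
move=> hp [mv sv]; have [E H] := hp; have mu : mono u.
  move=> W a b Eab; have [|h [_ U]] := H W (u ∘ a) (e ∘ a).
    by rewrite !compA E.
  rewrite -(U a) // -(U b) //; split=> //; apply: mv.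
  by rewrite !compA -E -!compA Eab.
split=> // S Q s a b hs Eab.
have [l [E1 E2]] : exists l : Q ~> B, l ∘ s = e ∘ a /\ v ∘ l = d ∘ b.
  by apply: sv => //; rewrite compA -E -!compA Eab.
have [h [E3 _]] := pullback_lift hp _ b l (eq_sym E2).
by exists h; split=> //; apply: mu; rewrite compA E3.
Qed.

Lemma pullback_unique {X Y B P P'} {d : X ~> Y} {v : B ~> Y}
    {u : P ~> X} {e : P ~> B} {u' : P' ~> X} {e' : P' ~> B} :
  strong_mono v -> is_pullback d v u e -> is_pullback d v u' e' ->
  exists h : P' ~> P, iso h /\ u' = u ∘ h /\ e' = e ∘ h.
Proof.
move=> sv hp hp'; have [mu _] := pullback_strong_mono hp sv.
have [mu' _] := pullback_strong_mono hp' sv.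
have [h [E1 E2]] := pullback_lift hp _ _ _ (proj1 hp').
have [k [E3 E4]] := pullback_lift hp' _ _ _ (proj1 hp).
exists h; split=> //; exists k; split.
  by apply: mu'; rewrite compA E3 E1 compm1.
by apply: mu; rewrite compA E1 E3 compm1.
Qed.

Lemma pullback_precomp_iso {X Y B P P'} {d : X ~> Y} {v : B ~> Y}
    {u : P ~> X} {e : P ~> B} {t : P' ~> P} :
  strong_mono v -> is_pullback d v u e -> iso t ->
  is_pullback d v (u ∘ t) (e ∘ t).
Proof.
move=> sv hp it; have su := pullback_strong_mono hp sv.
apply: pullback_mono_intro.
- by case: sv.
- by case: (strong_mono_comp su (iso_strong_mono it)).
- by rewrite !compA (proj1 hp).
- move=> W a b /(pullback_lift hp) [h [E _]]; have [s [_ Es]] := it.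
  by exists (s ∘ h); crw Es; rewrite compm1.
Qed.

Lemma pullback_iso {X Y B P} {d : X ~> Y} {v : B ~> Y} {u : P ~> X} {e : P ~> B} :
  strong_mono v -> is_pullback d v u e -> iso d -> iso e.
Proof.
move=> sv hp [g [E1 E2]].
have [|s [Es1 Es2]] := pullback_lift hp _ (g ∘ v) (idm B).
  by rewrite compA E2 comp1m compm1.
exists s; split=> //; have [mu _] := pullback_strong_mono hp sv.
apply: mu; rewrite compA Es1 -compA -(proj1 hp) compA E1 comp1m.
by rewrite compm1.
Qed.

Lemma pullback_iso_mono {X Y B P} {d : X ~> Y} {v : B ~> Y} {u : P ~> X} {e : P ~> B} :
  strong_mono v -> is_pullback d v u e -> (exists g : X ~> B, d = v ∘ g) -> iso u.
Proof.
move=> sv hp [g E].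
have [|s [Es1 _]] := pullback_lift hp _ (idm X) g; first by rewrite compm1.
exists s; split=> //; have [mu _] := pullback_strong_mono hp sv.
by apply: mu; rewrite compA Es1 comp1m compm1.
Qed.

Lemma pullback_hpaste {X Y B P B' P'} {d : X ~> Y} {v : B ~> Y} {u : P ~> X} {e : P ~> B}
    {w : B' ~> B} {t : P' ~> P} {e' : P' ~> B'} :
  strong_mono v -> strong_mono w ->
  is_pullback d v u e -> is_pullback e w t e' ->
  is_pullback d (v ∘ w) (u ∘ t) e'.
Proof.
move=> sv sw hp hp'.
apply: pullback_mono_intro.
- by case: (strong_mono_comp sv sw).
- by case: (strong_mono_comp (pullback_strong_mono hp sv) (pullback_strong_mono hp' sw)).
- by rewrite compA (proj1 hp) -compA (proj1 hp') compA.
- move=> W a b; rewrite -compA => /(pullback_lift hp) [h [E1 E2]].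
  have [h' [E3 _]] := pullback_lift hp' _ _ _ E2.
  by exists h'; rewrite -compA E3.
Qed.

Lemma pullback_hcancel {X Y B P B' P'} {d : X ~> Y} {v : B ~> Y} {u : P ~> X} {e : P ~> B}
    {w : B' ~> B} {t : P' ~> P} {e' : P' ~> B'} :
  strong_mono v -> strong_mono w ->
  is_pullback d v u e -> is_pullback d (v ∘ w) (u ∘ t) e' ->
  is_pullback e w t e'.
Proof.
move=> sv sw hp hp'; have [mu _] := pullback_strong_mono hp sv.
apply: pullback_mono_intro.
- by case: sw.
- have st := pullback_strong_mono hp' (strong_mono_comp sv sw).
  by case: (strong_mono_cancel st).
- by case: sv => mv _; apply: mv; rewrite compA -(proj1 hp) -compA (proj1 hp') compA.
- move=> W a b E.
  have [|h [E1 _]] := pullback_lift hp' _ (u ∘ a) b.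
    by rewrite compA (proj1 hp) -compA E compA.
  by exists h; apply: mu; rewrite compA.
Qed.

Lemma pullback_vpaste {X X' Y B P P'} {d : X ~> Y} {v : B ~> Y} {u : P ~> X} {e : P ~> B}
    {d' : X' ~> X} {u' : P' ~> X'} {t : P' ~> P} :
  strong_mono v ->
  is_pullback d v u e -> is_pullback d' u u' t ->
  is_pullback (d ∘ d') v u' (e ∘ t).
Proof.
move=> sv hp hp'; have su := pullback_strong_mono hp sv.
apply: pullback_mono_intro.
- by case: sv.
- by case: (pullback_strong_mono hp' su).
- by rewrite -compA (proj1 hp') compA (proj1 hp) -compA.
- move=> W a b; rewrite -compA => /(pullback_lift hp) [h [E1 E2]].
  have [h' [E3 _]] := pullback_lift hp' _ _ _ (eq_sym E1).
  by exists h'.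
Qed.

Lemma pullback_vcancel {X X' Y B P P'} {d : X ~> Y} {v : B ~> Y} {u : P ~> X} {e : P ~> B}
    {d' : X' ~> X} {u' : P' ~> X'} {t : P' ~> P} {e' : P' ~> B} :
  strong_mono v ->
  is_pullback d v u e -> is_pullback (d ∘ d') v u' e' -> d' ∘ u' = u ∘ t ->
  is_pullback d' u u' t.
Proof.
move=> sv hp hp' E; have [mu _] := pullback_strong_mono hp sv.
apply: pullback_mono_intro => //.
- by case: (pullback_strong_mono hp' sv).
- move=> W a b Eab.
  have [|h [E1 _]] := pullback_lift hp' _ a (e ∘ b).
    by rewrite -compA Eab compA (proj1 hp) compA.
  by exists h.
Qed.

Lemma pullback_factor {X I Y B P} {d : X ~> I} {n : I ~> Y} {s : B ~> I}
    {u : P ~> X} {e : P ~> B} :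
  mono n -> is_pullback (n ∘ d) (n ∘ s) u e -> is_pullback d s u e.
Proof.
move=> mn [E H]; split; first by apply: mn; rewrite !compA.
by move=> W a b Eab; apply: H; rewrite -!compA Eab.
Qed.

Lemma pushout_epi {X Y Z P} {u : Z ~> X} {f : Z ~> Y} {p : X ~> P} {q : Y ~> P} :
  is_pushout u f p q -> epi f -> epi p.
Proof.
move=> [E H] hf W g h Egh; have Eq : g ∘ q = h ∘ q.
  by apply: hf; rewrite -!compA -E !compA Egh.
have [|k [_ U]] := H W (g ∘ p) (g ∘ q); first by rewrite -!compA E.
by rewrite -(U g) // (U h).
Qed.

Lemma pushout_desc {X Y Z P} {u : Z ~> X} {f : Z ~> Y} {p : X ~> P} {q : Y ~> P} :
  is_pushout u f p q ->
  forall W (a : X ~> W) (b : Y ~> W), a ∘ u = b ∘ f ->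
  exists h : P ~> W, h ∘ p = a /\ h ∘ q = b.
Proof. by move=> [_ H] W a b /H [h [E _]]; exists h. Qed.

(** * Final pullback complements in an arbitrary category *)

Lemma final_pullback_complement_comp {A A1 D B X1 X} {e1 : A ~> A1} {e2 : A1 ~> D}
    {m : D ~> B} {c1 : X1 ~> B} {u1 : A1 ~> X1} {c : X ~> X1} {u : A ~> X} :
  strong_mono m ->
  final_pullback_complement e2 m c1 u1 -> final_pullback_complement e1 u1 c u ->
  final_pullback_complement (e2 ∘ e1) m (c1 ∘ c) u.
Proof.
move=> sm [hp1 H1] [hp H]; split; first exact: pullback_vpaste hp1 hp.
move=> X' A' c' u' e' hp' f Ef.
have [|h1 [[E1 E2] U1]] := H1 _ _ _ _ _ hp' (e1 ∘ f); first by rewrite compA.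
(* The first universal property turns the given square into one over [u1], to which the second
   applies. *)
have hp1' : is_pullback h1 u1 u' (e1 ∘ f).
  by apply: pullback_vcancel hp1 _ E2 => //; rewrite E1; exact: hp'.
have [h [[E3 E4] U]] := H _ _ _ _ _ hp1' f eq_refl.
exists h; split; first by rewrite -compA E3.
move=> h' [E5 E6]; apply: U; split=> //; apply/eq_sym/U1; split.
  by rewrite compA.
by rewrite -compA E6 compA (proj1 hp) compA.
Qed.

Lemma final_pullback_complement_F_terminal {A D B X} {e : A ~> D}
    {m : D ~> B} {c : X ~> B} {u : A ~> X} :
  epi c -> final_pullback_complement e m c u -> F_terminal e m c u.
Proof.
move=> hc [hp H]; split; first by split.
move=> X' c' u' [_ hp']; have [h [[E1 E2] U]] := H _ _ _ _ _ hp' (idm A) (compm1 e).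
by rewrite compm1 in E2; exists h; split=> // h' [E3 E4]; apply: U; rewrite compm1.
Qed.

(** Terminality gives comparison maps [h] and [g] with [g ∘ h = idm X]; maps to [X] are then
    obtained by composing with [g] and compared after composing with [h]. *)
Lemma F_terminal_final_pullback_complement {A D B X X0} {e : A ~> D}
    {m : D ~> B} {c : X ~> B} {u : A ~> X} {c0 : X0 ~> B} {u0 : A ~> X0} :
  epi c0 -> final_pullback_complement e m c0 u0 -> F_terminal e m c u ->
  final_pullback_complement e m c u.
Proof.
move=> hc0 fpc [O H]; have [O0 H0] := final_pullback_complement_F_terminal hc0 fpc.
have [h [[E1 E2] _]] := H0 _ _ _ O; have [g [[E3 E4] _]] := H _ _ _ O0.
have [i [_ Ui]] := H _ _ _ O.
have gh : g ∘ h = idm X.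
  rewrite -(Ui (idm X)) ?comp1m ?compm1 //; apply/eq_sym/Ui.
  by rewrite -compA E1 compA E4.
split; first by case: O.
move=> X' A' c' u' e' hp f Ef; have [k [[E5 E6] U]] := proj2 fpc _ _ _ _ _ hp f Ef.
exists (g ∘ k); split; first by rewrite compA E4 -compA E6 compA E3.
move=> w [Ew1 Ew2]; rewrite (U (h ∘ w)) ?compA ?gh ?comp1m //.
by rewrite E2 -compA Ew2 compA E1.
Qed.

Lemma final_pullback_complement_idm {D B : C} {m : D ~> B} :
  strong_mono m -> final_pullback_complement (idm D) m (idm B) m.
Proof.
move=> [mm _]; split.
  apply: pullback_mono_intro => //; first by rewrite comp1m compm1.
  by move=> W a b; rewrite comp1m => ->; exists b.
move=> X' A' c' u' e' [E _] f; rewrite comp1m => ->; exists c'.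
by split=> [|h [<- _]]; rewrite comp1m.
Qed.

End Arrows.

(** * Lists of arrows with varying codomain *)

Lemma Finite_list {U : Type} {S : Ensemble U} :
  Finite U S -> exists l : list U, forall x, S x -> In x l.
Proof.
elim=> [|P _ [l hl] x _]; first by exists nil.
by exists (x :: l)%list => _ [y /hl|y []]; [right|left].
Qed.

(** Equality of the packed composites also identifies the codomains, after which [a] cancels. *)
Lemma postcomp_injective {C : category} {X Y : C} {a : X ~> Y} : epi a ->
  Injective
    (fun g : {Z : C & Y ~> Z} => existT (fun Z : C => X ~> Z) (projT1 g) (projT2 g ∘ a)).
Proof.
move=> ha [Z g] [Z' g'] /= E.
move: (projT1_eq E) (projT2_eq E) => /= p; case: _ / p g' E => g' _ /= E.
by rewrite (ha _ _ _ E).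
Qed.

(** * Points, fibres and isomorphisms under the axioms *)

Section NineAxioms.
Context {C : category} {T : terminal_object C} (hC : nine_axioms T).
Implicit Types A B D K X Y : C.

Lemma to_one_eq {X} (f g : X ~> one T) : f = g.
Proof. by rewrite (to_one_unique f) (to_one_unique g). Qed.

Lemma point_strong_mono {X} (j : one T ~> X) : strong_mono j.
Proof. by apply: (split_mono_strong (r := to_one T X)); apply: to_one_eq. Qed.

(** (A6) over the base [1] provides an epimorphism [d] to [1]; the fibre inclusion [u] is
    invertible, being a pullback of an identity. *)
Lemma to_one_epi A : epi (to_one T A).
Proof.
have [X [d [u [[_ [hd hp]] _]]]] := F_point_has_terminal hC A (idm (one T)).
have si : strong_mono (idm (one T)) := point_strong_mono _.
have iu : iso u.
  by apply: pullback_iso_mono hp _ => //; exists d; rewrite comp1m.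
by rewrite -(to_one_unique (d ∘ u)); apply: epi_comp hd (iso_epi iu).
Qed.

Lemma pullback_epi {X Y B P} {d : X ~> Y} {v : B ~> Y} {u : P ~> X} {e : P ~> B} :
  epi d -> strong_mono v -> is_pullback d v u e -> epi e.
Proof.
move=> hd sv hp; have [P' [p [q [hp' hq]]]] := epi_pullback_strong_mono hC hd sv.
have [h [ih [_ ->]]] := pullback_unique sv hp' hp.
exact: epi_comp hq (iso_epi ih).
Qed.

Lemma iso_over_point_iso {X Y P} {d : X ~> Y} {j : one T ~> Y} {p : P ~> X} {q : P ~> one T} :
  is_pullback d j p q -> iso_over_point d j -> iso q.
Proof.
move=> hp [P' [p' [q' [hp' iq]]]].
have [h [ih [_ ->]]] := pullback_unique (point_strong_mono j) hp' hp.
exact: iso_comp.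
Qed.

Lemma iso_over_point_of_iso {X Y} {d : X ~> Y} (j : one T ~> Y) :
  iso d -> iso_over_point d j.
Proof.
move=> id; have sj := point_strong_mono j.
have [P [p [q [hp _]]]] := epi_pullback_strong_mono hC (iso_epi id) sj.
by exists P, p, q; split=> //; apply: pullback_iso hp id.
Qed.

Lemma iso_over_pointP {X Y B P} {d : X ~> Y} {v : B ~> Y} {u : P ~> X} {e : P ~> B}
    (j : one T ~> B) :
  strong_mono v -> is_pullback d v u e ->
  iso_over_point d (v ∘ j) <-> iso_over_point e j.
Proof.
move=> sv hp; have sj := point_strong_mono j; split=> [][Q [p [q [hq iq]]]].
  have [|t [E1 E2]] := pullback_lift hp _ p (j ∘ q).
    by rewrite (proj1 hq) compA.
  exists Q, t, q; split=> //; apply: pullback_hcancel hp _ => //.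
  by rewrite E1.
exists Q, (u ∘ p), q; split=> //; exact: pullback_hpaste hp hq.
Qed.

Lemma iso_over_points_iso {X Y} {d : X ~> Y} :
  epi d -> (forall j : one T ~> Y, iso_over_point d j) -> iso d.
Proof.
by move=> hd H; apply/is_identity_iso/(iso_over_all_points_identity hC hd).
Qed.

(** An isomorphism has trivial fibres, so by (A9) it is an identity: the category is skeletal. *)
Lemma iso_eq {X Y} {d : X ~> Y} : iso d -> X = Y.
Proof.
move=> id; apply: is_identity_eq; apply: (iso_over_all_points_identity hC (iso_epi id)).
by move=> j; apply: iso_over_point_of_iso.
Qed.

Lemma epi_point_eq {D} {j : one T ~> D} : epi j -> D = one T.
Proof.
by move=> hj; rewrite -(iso_eq (epi_strong_mono_iso hj (point_strong_mono j))).
Qed.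

Lemma strong_subobject_one {D B} {m : D ~> B} : strong_mono m -> B = one T -> D = one T.
Proof.
move=> sm E; subst B; apply: iso_eq (epi_strong_mono_iso _ sm).
by rewrite (to_one_unique m); apply: to_one_epi.
Qed.

(** * Strong subobjects, fibres and terminal objects of [F(A, j)] *)

Lemma strong_subobject_contains_fibre {A D I P} {e : A ~> D} {i : I ~> A}
    {j : one T ~> D} {p : P ~> A} {q : P ~> one T} :
  strong_mono i -> epi (e ∘ i) -> D <> one T -> is_pullback e j p q ->
  exists l : P ~> I, i ∘ l = p.
Proof.
move=> si hei hD hp; have sj := point_strong_mono j.
have sp := pullback_strong_mono hp sj.
(* [W] is the part of the fibre [P] lying in [I], the common subobject that (A8) needs. *)
have [W [w [r [hw _]]]] := epi_pullback_strong_mono hC hei sj.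
have sw := pullback_strong_mono hw sj.
have [|t [Et _]] := pullback_lift hp _ (i ∘ w) r.
  by rewrite compA (proj1 hw).
have st : strong_mono t.
  by apply: (strong_mono_cancel (g := p)); rewrite Et; apply: strong_mono_comp.
(* If instead [I] lay inside [P], then [e ∘ i] would factor through [j], making [j] an epimorphism
   and [D] equal to [1]. *)
case: (strong_mono_square_comparable hC sw st si sp (eq_sym Et)) => -[h [_ E]];
  last by exists h.
case: hD; apply: (@epi_point_eq _ j); apply: (epi_cancel (f := q ∘ h)).
by rewrite compA -(proj1 hp) -compA E.
Qed.

(* Pushing [e ∘ i] out along [i] reduces to the case of a section [v] of an
   epimorphism [r]: its image contains every fibre of [r], so all of them are
   trivial and [r] is an identity. *)
Lemma strong_subobject_full {A D I} {e : A ~> D} {i : I ~> A} :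
  strong_mono i -> epi (e ∘ i) -> D <> one T -> iso i.
Proof.
move=> si hei hD.
have [Y [c [v [po [sv hp]]]]] := strong_mono_pushout_epi hC si hei.
have [|r [Erc Erv]] := pushout_desc po _ e (idm D); first by rewrite comp1m.
have hrv : epi (r ∘ v) by rewrite Erv; apply: iso_epi; apply: iso_idm.
have hr := epi_cancel hrv.
have ir : iso r.
  apply: iso_over_points_iso => // j; have sj := point_strong_mono j.
  have [P [p [q [hp' _]]]] := epi_pullback_strong_mono hC hr sj.
  exists P, p, q; split=> //.
  have [l El] := strong_subobject_contains_fibre sv hrv hD hp'.
  have [|t [Et _]] := pullback_lift hp' _ (v ∘ j) (idm _).
    by rewrite compA Erv comp1m compm1.
  exists t; split; last exact: to_one_eq.
  (* Since [p] factors through [v] and [r ∘ v] is the identity, [v ∘ r ∘ p = p]; this makes [t]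
     inverse to [q]. *)
  have [mp _] := pullback_strong_mono hp' sj; apply: mp.
  by rewrite compA Et -compA -(proj1 hp') -El; crw Erv; rewrite ?compm1.
have iv : iso v.
  exists r; split=> //; have [mr _] := iso_strong_mono ir.
  by apply: mr; rewrite compA Erv comp1m compm1.
have [g [_ Eg]] := iv.
apply: pullback_iso_mono sv hp _; exists (g ∘ c).
by rewrite compA Eg comp1m.
Qed.

(* Otherwise collapsing the fibre over [b] would produce another object of
   [F(A, j)], and terminality would split the collapse. *)
Lemma F_point_terminal_iso_over {A B X} {j b : one T ~> B} {d : X ~> B} {u : A ~> X} :
  F_point_terminal j d u -> b <> j -> iso_over_point d b.
Proof.
move=> [O H] hb; apply: NNPP => nb; have [su [hd hp]] := O.
have sb := point_strong_mono b; have sj := point_strong_mono j.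
have [P [p [q [hpb hq]]]] := epi_pullback_strong_mono hC hd sb.
have nq : ~ iso q by move=> iq; apply: nb; exists P, p, q.
have sp := pullback_strong_mono hpb sb.
have [Y [c [v [po [sv hpv]]]]] := strong_mono_pushout_epi hC sp hq.
have hc := pushout_epi po hq.
(* [1] has a single point, so (A5) applies to [q]. *)
have [_ off] : iso_off_one_point T c.
  apply: (iso_off_one_point_pushout hC sp _ po); split=> // *; exact: to_one_eq.
have nv : ~ iso_over_point c v by move=> /(iso_over_point_iso hpv).
have [r [Erc Erv]] := pushout_desc po _ d b (proj1 hpb).
have hr : epi r by apply: (epi_cancel (f := c)); rewrite Erc.
have [K [k [s [hk _]]]] := epi_pullback_strong_mono hC hr sj.
have sk := pullback_strong_mono hk sj.
have [|t [Et _]] := pullback_lift hk _ (c ∘ u) (to_one T A).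
  by rewrite compA Erc (proj1 hp).
have ht : is_pullback c k u t.
  by apply: pullback_vcancel hk _ (eq_sym Et) => //; rewrite Erc; exact: hp.
(* The only nontrivial fibre of [c] lies over [v], and [r ∘ v = b] differs from [j]; so [c] is
   invertible over the fibre of [r] at [j]. *)
have it : iso t.
  apply: iso_over_points_iso; first exact: pullback_epi hc sk ht.
  move=> y; apply/(iso_over_pointP _ sk ht); apply: NNPP => ny.
  apply: hb; rewrite -Erv (off _ _ nv ny) compA (proj1 hk) -compA.
  by rewrite (to_one_eq (s ∘ y) (idm _)) compm1.
have O' : F_point_obj j r (c ∘ u).
  split; first by rewrite -Et; apply: strong_mono_comp sk (iso_strong_mono it).
  split=> //; rewrite -Et (to_one_eq (to_one T A) (s ∘ t)).
  exact: pullback_precomp_iso.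
(* Terminality makes [h ∘ c] the identity, so the epimorphism [c] is invertible, and with it its
   pullback [q]. *)
have [h [[E1 E2] _]] := H _ _ _ O'; have [i [_ U]] := H _ _ _ O.
apply: nq; apply: pullback_iso sv hpv (epi_section_iso (r := h) _ hc).
rewrite -(U (idm X)) ?comp1m ?compm1 //; apply/eq_sym/U.
by rewrite -compA E1 compA E2 Erc.
Qed.

(** The image of [h] maps onto [B], hence is all of [X'], so [h] is an epimorphism. Its fibres over
    points above [j] are those of [idm A]; the others are controlled by the trivial fibres of
    [d]. *)
Lemma F_point_morphism_iso {A B X X'} {j : one T ~> B} {d : X ~> B} {u : A ~> X}
    {d' : X' ~> B} {u' : A ~> X'} {h : X ~> X'} :
  B <> one T -> F_point_obj j d u -> (forall b, b <> j -> iso_over_point d b) ->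
  F_point_obj j d' u' -> h ∘ u = u' -> d' ∘ h = d -> iso h.
Proof.
move=> hB [su [hd hp]] triv [su' [hd' hp']] E1 E2; have sj := point_strong_mono j.
have hh : epi h.
  have [I [g [i [hg [si Eh]]]]] := epi_strong_mono_factorization hC h.
  have ii : iso i.
    apply: (strong_subobject_full (e := d') si _ hB).
    by apply: (epi_cancel (f := g)); rewrite -compA -Eh E2.
  by rewrite Eh; apply: epi_comp (iso_epi ii) hg.
apply: iso_over_points_iso => // y.
case: (classic (d' ∘ y = j)) => [Ey|ny].
  have [|z [<- _]] := pullback_lift hp' _ y (idm _); first by rewrite Ey compm1.
  apply/(iso_over_pointP (e := idm A) (u := u)) => //.
    by apply: pullback_vcancel hp' _ _; rewrite ?E2 ?compm1 //; exact: hp.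
  exact: iso_over_point_of_iso (iso_idm A).
have sb := point_strong_mono (d' ∘ y).
have [P' [p' [q' [hP' _]]]] := epi_pullback_strong_mono hC hd' sb.
have [P [p [q [hP iq]]]] := triv _ ny.
have sp' := pullback_strong_mono hP' sb.
have [|t [Et _]] := pullback_lift hP' _ (h ∘ p) q.
  by rewrite compA E2 (proj1 hP).
have ht : is_pullback h p' p t.
  by apply: pullback_vcancel hP' _ (eq_sym Et) => //; rewrite E2; exact: hP.
have [|z [<- _]] := pullback_lift hP' _ y (idm _); first by rewrite compm1.
apply/(iso_over_pointP _ sp' ht); apply: iso_over_point_of_iso.
(* The map [t] of fibres is epic as a pullback of [h], and split monic because the fibre [P] of [d]
   is isomorphic to [1]. *)
apply: epi_strong_mono_iso; first exact: pullback_epi hh sp' ht.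
have [r [Er _]] := iq; apply: (split_mono_strong (r := r ∘ q')).
by rewrite -compA (to_one_eq (q' ∘ t) q).
Qed.

(** The morphism to the terminal object supplied by (A6) is invertible by [F_point_morphism_iso], so
    terminality transfers. *)
Lemma F_point_terminal_intro {A B X} {j : one T ~> B} {d : X ~> B} {u : A ~> X} :
  B <> one T -> F_point_obj j d u -> (forall b, b <> j -> iso_over_point d b) ->
  F_point_terminal j d u.
Proof.
move=> hB O triv; split=> //.
have [X0 [d0 [u0 [O0 H0]]]] := F_point_has_terminal hC A j.
have [h [[E1 E2] _]] := H0 _ _ _ O.
have [g [gh hg]] := F_point_morphism_iso hB O triv O0 E1 E2.
move=> X' d' u' /H0 [w [[E3 E4] U]]; exists (g ∘ w); split.
  rewrite -compA E3 -E1 compA gh comp1m; split=> //.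
  by rewrite -E2; crw hg; rewrite compm1.
move=> w' [E5 E6]; rewrite (U (h ∘ w')) ?compA ?gh ?comp1m //.
by rewrite E2 -compA E5.
Qed.

(** * Final pullback complements of collapses of a single fibre *)

Lemma F_point_obj_paste {K A D B X} {k : K ~> A} {a : A ~> D} {j : one T ~> D}
    {m : D ~> B} {c : X ~> B} {u : A ~> X} :
  F_point_obj j a k -> strong_mono m -> epi c -> is_pullback c m u a ->
  F_point_obj (m ∘ j) c (u ∘ k).
Proof.
move=> [sk [_ hk]] sm hc hp; split.
  exact: strong_mono_comp (pullback_strong_mono hp sm) sk.
by split=> //; apply: pullback_hpaste hp hk => //; apply: point_strong_mono.
Qed.

(* [f] is epi because [D <> 1]; pushing [u'] out along [f] turns the map to be
   constructed into a morphism of [F(K, s ∘ j)]. *)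
Lemma epi_final_pullback_complement {K A D B X X' A'} {k : K ~> A} {a : A ~> D}
    {j : one T ~> D} {s : D ~> B} {c : X ~> B} {u : A ~> X} {c' : X' ~> B}
    {u' : A' ~> X'} {e' : A' ~> D} {f : A' ~> A} :
  F_point_terminal j a k -> D <> one T -> strong_mono s ->
  is_pullback c s u a -> F_point_terminal (s ∘ j) c (u ∘ k) ->
  epi c' -> is_pullback c' s u' e' -> a ∘ f = e' ->
  exists! h : X' ~> X, c ∘ h = c' /\ h ∘ u' = u ∘ f.
Proof.
move=> [Oa Ta] hD ss hp [Oc Tc] hc' hp' Ef; have he' := pullback_epi hc' ss hp'.
have su := pullback_strong_mono hp ss; have su' := pullback_strong_mono hp' ss.
have hf : epi f.
  have [I [g [i [hg [si Eh]]]]] := epi_strong_mono_factorization hC f.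
  have ii : iso i.
    apply: (strong_subobject_full (e := a) si _ hD).
    by apply: (epi_cancel (f := g)); rewrite -compA -Eh Ef.
  by rewrite Eh; apply: epi_comp (iso_epi ii) hg.
have [Y [y [v [po [sv _]]]]] := strong_mono_pushout_epi hC su' hf.
have hy := pushout_epi po hf.
have [|r [Ery Erv]] := pushout_desc po _ c' (s ∘ a).
  by rewrite (proj1 hp') -Ef compA.
have hr : epi r by apply: (epi_cancel (f := y)); rewrite Ery.
have [P [p [q [hP _]]]] := epi_pullback_strong_mono hC hr ss.
have sp := pullback_strong_mono hP ss.
have [t [Et1 Et2]] := pullback_lift hP _ v a Erv.
(* [t] is strong monic as a factor of [v], and epic because [t ∘ f] is a pullback of [y]; hence
   [(Y, r, v)] is a pullback complement of [(a, s)]. *)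
have it : iso t.
  apply: epi_strong_mono_iso; last first.
    by apply: (strong_mono_cancel (g := p)); rewrite Et1.
  apply: (epi_cancel (f := f)); apply: (pullback_epi hy sp (u := u')).
  apply: (pullback_vcancel ss hP (e' := e')); first by rewrite Ery.
  by rewrite (proj1 po) -Et1 compA.
have hv : is_pullback r s v a by rewrite -Et1 -Et2; apply: pullback_precomp_iso.
have [w [[Ew1 Ew2] Uw]] := Tc _ _ _ (F_point_obj_paste Oa ss hr hv).
have Ewv : w ∘ v = u.
  (* So far [w ∘ v] and [u] agree after composing with [k]; their comparison [g] is an endomorphism
     of the terminal object [(A, a, k)], hence the identity. *)
  have [|g [Eg1 Eg2]] := pullback_lift hp _ (w ∘ v) a; first by rewrite compA Ew2.
  have [i [_ Ui]] := Ta _ _ _ Oa.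
  have Eg : g = idm A.
    rewrite -(Ui (idm A)) ?comp1m ?compm1 //; apply/eq_sym/Ui; split=> //.
    by case: su => mu _; apply: mu; rewrite compA Eg1 -Ew1 compA.
  by rewrite -Eg1 Eg compm1.
exists (w ∘ y); split.
  by rewrite compA Ew2 Ery -compA (proj1 po) compA Ewv.
(* By the pushout any competitor [h] factors through [y], via a morphism determined by
   terminality. *)
move=> h [E1 E2]; have [w' [Ew'1 Ew'2]] := pushout_desc po _ _ _ E2.
rewrite (Uw w') //; rewrite compA Ew'2; split=> //.
by apply: hy; rewrite -compA Ew'1 E1.
Qed.

(** The complement is the terminal object of [F(K, m ∘ j)]: its restriction along [m] again has
    trivial fibres off [j], so it is isomorphic to [A]. For the universal property, [c'] is reduced
    to its image [I], which (A8) compares with [D]. *)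
Lemma one_point_final_pullback_complement {K A D B} {k : K ~> A} {a : A ~> D}
    {j : one T ~> D} {m : D ~> B} :
  F_point_obj j a k -> (forall b, b <> j -> iso_over_point a b) ->
  strong_mono m -> D <> one T ->
  exists (X : C) (c : X ~> B) (u : A ~> X),
    epi c /\ final_pullback_complement a m c u.
Proof.
move=> Oa triv sm hD; have [mm _] := sm.
have [X [c [w TX]]] := F_point_has_terminal hC K (m ∘ j).
have trivc b : b <> m ∘ j -> iso_over_point c b := F_point_terminal_iso_over TX.
have [[sw [hc hw]] _] := TX.
have [P [p [q [hP hq]]]] := epi_pullback_strong_mono hC hc sm.
have [|k' [Ek1 Ek2]] := pullback_lift hP _ w (j ∘ to_one T K).
  by rewrite (proj1 hw) compA.
have sj := point_strong_mono j.
have hk' : is_pullback q j k' (to_one T K).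
  by apply: pullback_hcancel hP _ => //; rewrite Ek1.
have OP : F_point_obj j q k' by split=> //; apply: pullback_strong_mono hk' sj.
have trivq b : b <> j -> iso_over_point q b.
  by move=> nb; apply/(iso_over_pointP _ sm hP)/trivc => /mm.
have [h [[Eh1 Eh2] _]] := proj2 (F_point_terminal_intro hD OP trivq) _ _ _ Oa.
have ih := F_point_morphism_iso hD Oa triv OP Eh1 Eh2.
have hp : is_pullback c m (p ∘ h) a.
  by rewrite -Eh2; apply: pullback_precomp_iso.
exists X, c, (p ∘ h); split=> //; split=> //.
move=> X' A' c' u' e' hp' f Ef.
have [I [g [n [hg [sn Ec']]]]] := epi_strong_mono_factorization hC c'.
(* The image [J] of [e'] becomes the common strong subobject of [I] and [D] that (A8) requires. *)
have [J [e1 [m1 [he1 [sm1 Ee']]]]] := epi_strong_mono_factorization hC e'.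
have [|l [_ El]] := proj2 sn _ _ e1 (g ∘ u') (m ∘ m1) he1.
  by rewrite compA -Ec' -compA -Ee' (proj1 hp').
have snl : strong_mono (n ∘ l) by rewrite El; apply: strong_mono_comp.
have sl := strong_mono_cancel snl.
case: (strong_mono_square_comparable hC sl sm1 sn sm El) => -[s [_ Es]].
  (* If [I] lies in [D], then [c'] factors through [m], so [u'] is invertible and determines the
     map. *)
  have iu' : iso u'.
    by apply: pullback_iso_mono sm hp' _; exists (s ∘ g); rewrite compA Es.
  have [v [vu uv]] := iu'; exists (p ∘ h ∘ f ∘ v); split.
    split; last by crw vu; rewrite compm1.
    rewrite !compA -(compA c p h) (proj1 hp).
    by crw Ef; rewrite -(proj1 hp'); crw uv; rewrite compm1.
  move=> x [_ Ex]; rewrite -Ex; crw uv; by rewrite compm1.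
(* If [D] lies in [I], the complement is pulled back along [n] to the base [I], onto which [g] is an
   epimorphism. *)
have ss : strong_mono s by apply: (strong_mono_cancel (g := n)); rewrite Es.
have hI : I <> one T by move=> /(strong_subobject_one ss).
have [XI [pn [cI [hI1 hcI]]]] := epi_pullback_strong_mono hC hc sn.
have [|uI [EuI _]] := pullback_lift hI1 _ (p ∘ h) (s ∘ a).
  by rewrite (proj1 hp) compA Es.
have hpI : is_pullback cI s uI a.
  by apply: pullback_hcancel hI1 _ => //; rewrite EuI Es.
have hp'I : is_pullback g s u' e'.
  by case: sn => mn _; apply: pullback_factor mn _; rewrite Es -Ec'.
have TA := F_point_terminal_intro hD Oa triv.
have TI : F_point_terminal (s ∘ j) cI (uI ∘ k).
  apply: F_point_terminal_intro hI (F_point_obj_paste Oa ss hcI hpI) _ => b nb.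
  apply/(iso_over_pointP _ sn hI1)/trivc; rewrite -Es -compA.
  by case: sn => mn _ /mn.
have [x [[Ex1 Ex2] U]] := epi_final_pullback_complement TA hD ss hpI TI hg hp'I Ef.
exists (pn ∘ x); split.
  by rewrite compA (proj1 hI1) -compA Ex1 -Ec' -compA Ex2 compA EuI.
move=> x' [Ex'1 Ex'2].
have [|z [Ez1 Ez2]] := pullback_lift hI1 _ x' g; first by rewrite Ex'1.
rewrite -Ez1 (U z) //; split=> //.
have [mpn _] := pullback_strong_mono hI1 sn.
by apply: mpn; rewrite !compA Ez1 EuI Ex'2.
Qed.

(** * Counting epimorphisms and the inductive construction *)

Definition epis_bounded A (n : nat) : Prop :=
  forall l : list {Y : C & A ~> Y},
    NoDup l -> (forall f, In f l -> epi (projT2 f)) -> length l <= n.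

Lemma epis_bounded_exists A : exists n, epis_bounded A n.
Proof.
have [l hl] := Finite_list (finite_epis hC A); exists (length l) => l' nd hl'.
by apply: NoDup_incl_length nd _ => f /hl' /hl.
Qed.

(** Precomposition with [a] injects the epimorphisms out of [Y] into those out of [X] and misses
    [idm X], since otherwise [a] would be split monic and thus invertible. *)
Lemma epis_bounded_pred {X Y n} {a : X ~> Y} :
  epi a -> ~ iso a -> epis_bounded X n -> exists p, n = S p /\ epis_bounded Y p.
Proof.
move=> ha na bX; pose F := fun g : {Z : C & Y ~> Z} =>
  existT (fun Z : C => X ~> Z) (projT1 g) (projT2 g ∘ a).
have lt_n (l : list {Z : C & Y ~> Z}) :
    NoDup l -> (forall f, In f l -> epi (projT2 f)) -> S (length l) <= n.
{ move=> nd hl; rewrite -(length_map F).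
  apply: (bX (existT _ X (idm X) :: map F l)%list) => [|f [<-|]].
  - apply: NoDup_cons; last exact: (Injective_map_NoDup (postcomp_injective ha) nd).
    move=> /in_map_iff [[Z g] [Eg _]]; apply: na.
    move: (projT1_eq (eq_sym Eg)) (projT2_eq (eq_sym Eg)) => /= q.
    case: _ / q g Eg => g _ /= Eg.
    by apply: (epi_section_iso (r := g)) ha; rewrite -Eg.
  - exact: iso_epi (iso_idm X).
  - by move=> /in_map_iff [g [<- /hl hg]]; apply: epi_comp. }
(* Even the empty list leaves room for [idm X], so the bound is not zero. *)
case: n {bX} lt_n => [|p] lt_n.
  by have /PeanoNat.Nat.nle_succ_0 := lt_n nil (NoDup_nil _) (fun _ => False_ind _).
by exists p; split=> // l nd /(lt_n l nd) /le_S_n.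
Qed.

Lemma final_pullback_complement_exists {A D B} {e : A ~> D} {m : D ~> B} :
  epi e -> strong_mono m -> D <> one T ->
  exists (X : C) (c : X ~> B) (u : A ~> X),
    epi c /\ final_pullback_complement e m c u.
Proof.
have [n bA] := epis_bounded_exists A.
elim/(well_founded_induction Wf_nat.lt_wf): n => n IH in A D B e m bA *.
move=> he sm hD.
case: (classic (forall j : one T ~> D, iso_over_point e j)) => [triv|].
  have ide := iso_over_all_points_identity hC he triv.
  (* An identity, not just an isomorphism: the case analysis identifies [A] with [D]. *)
  case: ide m sm {he hD triv} => D' m sm; exists B, (idm B), m.
  by split; [exact: iso_epi (iso_idm B)|exact: final_pullback_complement_idm].
move=> /not_all_ex_not [j nj]; have sj := point_strong_mono j.
have [K [k [q [hk hq]]]] := epi_pullback_strong_mono hC he sj.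
have nq : ~ iso q by move=> iq; apply: nj; exists K, k, q.
have sk := pullback_strong_mono hk sj.
(* The fibre [K] is collapsed to the point [x], over which [a] has its only nontrivial fibre. *)
have [A1 [a [x [po [sx hx]]]]] := strong_mono_pushout_epi hC sk hq.
have ha := pushout_epi po hq.
have [_ off] : iso_off_one_point T a.
  by apply: (iso_off_one_point_pushout hC sk _ po); split=> // *; exact: to_one_eq.
have nx : ~ iso_over_point a x by move=> /(iso_over_point_iso hx).
have triv b : b <> x -> iso_over_point a b.
  by move=> nb; apply: NNPP => /(off _ _ nx) E; apply: nb.
have na : ~ iso a by move=> /(iso_over_point_of_iso x).
have [e1 [Ee1 _]] := pushout_desc po _ e j (proj1 hk).
have he1 : epi e1 by apply: (epi_cancel (f := a)); rewrite Ee1.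
have hA1 : A1 <> one T by move=> E; subst A1; exact: hD (epi_point_eq he1).
have [p [En bA1]] := epis_bounded_pred ha na bA.
have [|X1 [c1 [u1 [hc1 fpc1]]]] := IH p _ _ _ _ e1 m bA1 he1 sm hD.
  by rewrite En; apply: le_n.
have su1 := pullback_strong_mono (proj1 fpc1) sm.
have Oa : F_point_obj x a k.
  by split=> //; split=> //; rewrite (to_one_eq (to_one T K) q).
(* The complement for [a] is taken along [u1] rather than [m], so that it composes with the one for
   [e1]. *)
have [X [c [u [hc fpc]]]] := one_point_final_pullback_complement Oa triv su1 hA1.
exists X, (c1 ∘ c), u; split; first exact: epi_comp.
by rewrite -Ee1; apply: final_pullback_complement_comp fpc1 fpc.
Qed.

End NineAxioms.

Theorem theorem4p4 (C : category) (T : terminal_object C)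
    (hC : nine_axioms T) :
  (forall (A D B : C) (e : A ~> D) (m : D ~> B),
     epi e -> strong_mono m -> D <> one T ->
     (exists (X : C) (c : X ~> B) (u : A ~> X), F_terminal e m c u) /\
     (forall (X : C) (c : X ~> B) (u : A ~> X),
        F_terminal e m c u -> final_pullback_complement e m c u)) /\
  (forall (A B : C) (f : A ~> B), ~ constant T f ->
     forall (D : C) (e : A ~> D) (m : D ~> B),
       epi e -> strong_mono m -> f = m ∘ e ->
       exists (X : C) (c : X ~> B) (u : A ~> X),
         final_pullback_complement e m c u).
Proof.
split=> [A D B e m he sm hD|A B f nf D e m he sm Ef].
  have [X0 [c0 [u0 [hc0 fpc]]]] := final_pullback_complement_exists hC he sm hD.
  split; first by exists X0, c0, u0; apply: final_pullback_complement_F_terminal.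
  by move=> X c u; apply: F_terminal_final_pullback_complement fpc.
(* A factorization through [1] would make [f] constant. *)
have hD : D <> one T.
  by move=> E; subst D; apply: nf; exists m; rewrite Ef (to_one_unique e).
have [X [c [u [_ fpc]]]] := final_pullback_complement_exists hC he sm hD.
by exists X, c, u.
Qed.
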